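(* Let $\mathbf{X}\in\mathbb{R}^{n\times p}$, $\beta^*\in\mathbb{R}^p$, $\varepsilon\in\mathbb{R}^n$ and $y=\mathbf{X}\beta^*+\varepsilon$. Let $h:\mathbb{R}^p\to[0,+\infty]$ be a convex, proper function such that the minimization problem $\min_{\beta\in\mathbb{R}^p}\|\mathbf{A}\beta-z\|^2+2h(\beta)$ has at least one solution for every $z\in\mathbb{R}^n$ and every $\mathbf{A}\in\mathbb{R}^{n\times p}$, and let $\hat\beta\in\operatorname*{argmin}_{\beta\in\mathbb{R}^p}\|\mathbf{X}\beta-y\|^2+2h(\beta)$. Assume that $h(\beta^* )<+\infty$. Then $$\|\mathbf{X}(\hat\beta-\beta^* )\|\ \le\ \inf\{r>0:\ H(r)\le r\}.$$
   Context: $\|\cdot\|$ is the Euclidean norm. A function is proper if it is finite at at least one point. The function $H:(0,+\infty)\to\mathbb{R}$ (which depends on $\varepsilon$) is defined by $$H(t)=\sup_{\beta\in\mathbb{R}^p:\ \|\mathbf{X}(\beta-\beta^* )\|\le t}\frac{\varepsilon^T\mathbf{X}(\beta-\beta^* )+h(\beta^* )-h(\beta)}{t},\qquad t>0.$$ *)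

(* Defs.v *)
From HB Require Import structures.
From mathcomp Require Import all_boot all_order all_algebra.
From mathcomp Require Import all_classical all_reals ereal.

Set Implicit Arguments.
Unset Strict Implicit.
Unset Printing Implicit Defensive.

Import Order.TTheory GRing.Theory Num.Theory.

Local Open Scope classical_set_scope.
Local Open Scope ring_scope.

(* The norm MathComp-Analysis puts on matrices is the sup norm. *)
Definition enorm (R : realType) (m : nat) (v : 'cV[R]_m) : R :=
  Num.sqrt (\sum_(i < m) v i 0 ^+ 2).

Local Open Scope ereal_scope.

(* Meant for functions that never take the value -oo: the right-hand side is
   then never of the form +oo - oo. When l = 0 or l = 1 the inequality is
   trivial, since 0 * +oo = 0. *)
Definition econvex (R : realType) (p : nat) (h : 'cV[R]_p -> \bar R) : Prop :=
  forall (x y : 'cV[R]_p) (l : R), (0 <= l)%R -> (l <= 1)%R ->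
    h (l *: x + (1 - l) *: y)%R <= l%:E * h x + (1 - l)%:E * h y.

Definition proper_fun (R : realType) (p : nat) (h : 'cV[R]_p -> \bar R) : Prop :=
  exists x : 'cV[R]_p, h x \is a fin_num.

Definition is_argmin (R : realType) (p : nat) (f : 'cV[R]_p -> \bar R)
    (x : 'cV[R]_p) : Prop :=
  forall y : 'cV[R]_p, f x <= f y.

Definition penalized_ls (R : realType) (n p : nat) (h : 'cV[R]_p -> \bar R)
    (A : 'M[R]_(n, p)) (z : 'cV[R]_n) (b : 'cV[R]_p) : \bar R :=
  (enorm (A *m b - z) ^+ 2)%:E + 2%:E * h b.

(* The supremum is taken in \bar R because the quotient is -oo where
   h b = +oo. If 0 <= h and h bstar < +oo, then for t > 0 it is a real number:
   b = bstar gives 0 <= Hfun t, and Cauchy-Schwarz gives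
   Hfun t <= enorm eps + h bstar / t. *)
Definition Hfun (R : realType) (n p : nat) (X : 'M[R]_(n, p))
    (bstar : 'cV[R]_p) (eps : 'cV[R]_n) (h : 'cV[R]_p -> \bar R)
    (t : R) : \bar R :=
  ereal_sup [set ((((eps^T *m X *m (b - bstar))%R 0%R 0%R)%:E
                    + h bstar - h b) / t%:E)
             | b in [set b : 'cV[R]_p | (enorm (X *m (b - bstar)) <= t)%R]].

(* Main.v *)
Require Import Defs.
From HB Require Import structures.
From mathcomp Require Import all_boot all_order all_algebra.
From mathcomp Require Import all_classical all_reals ereal.
From mathcomp Require Import ring lra.

Set Implicit Arguments.
Unset Strict Implicit.
Unset Printing Implicit Defensive.

Import Order.TTheory GRing.Theory Num.Theory.

Local Open Scope classical_set_scope.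
Local Open Scope ring_scope.
Local Open Scope ereal_scope.

(* Put d = bhat - bstar and K = eps^T X d + h(bstar) - h(bhat). Comparing the
   objective at bhat with its values on the segment from bhat to bstar gives
   the first-order condition |X d|^2 <= K. If H(r) <= r and r < |X d|, the point
   b = bstar + l d with l = r / |X d| satisfies |X (b - bstar)| = r, and
   convexity bounds the numerator in H at b below by l K, hence by r |X d|.
   So r |X d| <= r H(r) <= r^2, a contradiction. *)

Lemma sqr_enorm (R : realType) (m : nat) (v : 'cV[R]_m) :
  (enorm v ^+ 2 = \sum_(i < m) v i 0 ^+ 2)%R.
Proof. by rewrite sqr_sqrtr// sumr_ge0// => i _; exact: sqr_ge0. Qed.

Lemma enorm_ge0 (R : realType) (m : nat) (v : 'cV[R]_m) : (0 <= enorm v)%R.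
Proof. exact: sqrtr_ge0. Qed.

Lemma enormZ (R : realType) (m : nat) (a : R) (v : 'cV[R]_m) :
  (0 <= a)%R -> (enorm (a *: v) = a * enorm v)%R.
Proof.
move=> a0; apply/eqP; rewrite -(@eqrXn2 _ 2)//; last 2 first.
- exact: enorm_ge0.
- by rewrite mulr_ge0// enorm_ge0.
rewrite exprMn !sqr_enorm mulr_sumr; apply/eqP/eq_bigr => i _.
by rewrite mxE exprMn.
Qed.

Lemma sqr_enormZB (R : realType) (m : nat) (a : R) (w e : 'cV[R]_m) :
  (enorm (a *: w - e) ^+ 2
   = a ^+ 2 * enorm w ^+ 2 - 2 * a * (e^T *m w) 0 0 + enorm e ^+ 2)%R.
Proof.
rewrite !sqr_enorm mxE !mulr_sumr -sumrB -big_split/=.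
by apply: eq_bigr => i _; rewrite !mxE; ring.
Qed.

(** This replaces the limit [t -> 0]: if [K < q], the single choice [t = (q - K) / q] turns the left
    side into [q + K], which exceeds [2 * K]. The case [t = 1] gives [0 <= K], so this choice is at
    most 1. *)
Lemma le_of_small_slope (R : realType) (q K : R) : (0 <= q)%R ->
  (forall t : R, 0 < t -> t <= 1 -> (2 - t) * q <= 2 * K)%R -> (q <= K)%R.
Proof.
move=> q0 H; rewrite leNgt; apply/negP => Kq.
have := H 1%R ltr01 (lexx _) => H1.
have qp : (0 < q)%R by lra.
have /H : (0 < (q - K) / q)%R by rewrite divr_gt0// subr_gt0.
have -> : ((2 - (q - K) / q) * q = q + K)%R by field; rewrite gt_eqF.
by rewrite ler_pdivrMr// => /(_ _); lra.
Qed.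

(** Nonnegativity excludes [-oo] and the real convexity bound excludes [+oo], so later estimates can
    be carried out in [R]. *)
Lemma econvex_fine (R : realType) (p : nat) (h : 'cV[R]_p -> \bar R)
    (x y : 'cV[R]_p) (l : R) :
  (forall b, 0 <= h b) -> econvex h -> h x \is a fin_num -> h y \is a fin_num ->
  (0 <= l)%R -> (l <= 1)%R ->
  h (l *: x + (1 - l) *: y)%R \is a fin_num /\
  (fine (h (l *: x + (1 - l) *: y)) <= l * fine (h x) + (1 - l) * fine (h y))%R.
Proof.
move=> h0 hc hx hy l0 l1; have := hc x y l l0 l1.
rewrite -{1}(fineK hx) -{1}(fineK hy) -!EFinM -EFinD => hle.
have hfin : h (l *: x + (1 - l) *: y)%R \is a fin_num.
  by rewrite ge0_fin_numE//; exact: le_lt_trans hle (ltry _).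
by split=> //; rewrite -lee_fin fineK.
Qed.

Lemma argmin_first_order (R : realType) (n p : nat) (X : 'M[R]_(n, p))
    (bstar bhat : 'cV[R]_p) (eps : 'cV[R]_n) (h : 'cV[R]_p -> \bar R) :
  (forall b, 0 <= h b) -> econvex h ->
  is_argmin (penalized_ls h X (X *m bstar + eps)%R) bhat ->
  h bstar \is a fin_num -> h bhat \is a fin_num ->
  (enorm (X *m (bhat - bstar)) ^+ 2
   <= (eps^T *m X *m (bhat - bstar)) 0 0 + fine (h bstar) - fine (h bhat))%R.
Proof.
move=> h0 hc hmin hs hh; apply: le_of_small_slope; first exact: sqr_ge0.
move=> t t0 t1; have [bfin ble] := econvex_fine h0 hc hs hh (ltW t0) t1.
set b := (t *: bstar + (1 - t) *: bhat)%R in bfin ble.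
have := hmin b; rewrite /penalized_ls -(fineK bfin) -(fineK hh).
rewrite -!EFinM -!EFinD lee_fin.
set w := (X *m (bhat - bstar))%R.
have -> : (X *m b - (X *m bstar + eps) = (1 - t) *: w - eps)%R.
  rewrite /w /b !mulmxDr mulmxN -!scalemxAr.
  by apply/matrixP => i j; rewrite !mxE; ring.
(* The scalar 1 is kept so that [sqr_enormZB] expands both residuals. *)
have -> : (X *m bhat - (X *m bstar + eps) = 1 *: w - eps)%R.
  by rewrite /w scale1r mulmxBr opprD addrA.
rewrite !sqr_enormZB -mulmxA -/w => hle.
(* The coefficients of [enorm w ^+ 2] differ by [1 - (1 - t)^2 = t * (2 - t)]; by [ble] the
   remaining terms contribute at most [2 * t * K]. Hence the goal is first multiplied by [t]. *)
rewrite -(ler_pM2l t0); nra.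
Qed.

Theorem theorem2p5 (R : realType) (n p : nat)
    (X : 'M[R]_(n, p)) (bstar : 'cV[R]_p) (eps y : 'cV[R]_n)
    (hy : y = (X *m bstar + eps)%R)
    (h : 'cV[R]_p -> \bar R)
    (h_ge0 : forall b : 'cV[R]_p, 0 <= h b)
    (h_convex : econvex h)
    (h_proper : proper_fun h)
    (h_argmin : forall (z : 'cV[R]_n) (A : 'M[R]_(n, p)),
        exists b : 'cV[R]_p, is_argmin (penalized_ls h A z) b)
    (bhat : 'cV[R]_p)
    (hbhat : is_argmin (penalized_ls h X y) bhat)
    (hbstar : h bstar < +oo) :
  (enorm (X *m (bhat - bstar)))%:E
    <= ereal_inf [set r%:E | r in [set r : R | (0 < r)%R
                                   /\ Hfun X bstar eps h r <= r%:E]].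
Proof.
have hs : h bstar \is a fin_num by rewrite ge0_fin_numE.
(* Otherwise the objective would be [+oo] at its minimizer [bhat], yet it is finite at [bstar]. *)
have hh : h bhat \is a fin_num.
  rewrite ge0_fin_numE// ltNge leye_eq; apply/negP => /eqP hoo.
  have := hbhat bstar; rewrite /penalized_ls hoo -(fineK hs) -EFinM -EFinD.
  by rewrite gt0_muley ?lte_fin// addey// leye_eq.
apply: le_ereal_inf_tmp => _ [r [r0 Hr] <-]; rewrite lee_fin.
rewrite hy in hbhat.
have := argmin_first_order h_ge0 h_convex hbhat hs hh.
set w := (X *m (bhat - bstar))%R; set s := enorm w => fo.
rewrite leNgt; apply/negP => rs.
have s0 : (0 < s)%R by exact: lt_trans rs.
pose l := (r / s)%R.
have l0 : (0 < l)%R by rewrite divr_gt0.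
have l1 : (l <= 1)%R by rewrite ler_pdivrMr// mul1r ltW.
have lsr : (l * s = r)%R by rewrite divfK// gt_eqF.
have [bfin ble] := econvex_fine h_ge0 h_convex hh hs (ltW l0) l1.
set b := (l *: bhat + (1 - l) *: bstar)%R in bfin ble.
have bE : (b - bstar = l *: (bhat - bstar))%R.
  by apply/matrixP => i j; rewrite !mxE; ring.
have : ((eps^T *m X *m (b - bstar))%R 0%R 0%R)%:E + h bstar - h b <= (r * r)%:E.
  rewrite EFinM -lee_pdivrMr//; apply: le_trans Hr.
  (* The extended inverse of [r%:E] is the real one because [r] is nonzero. *)
  apply: ereal_sup_ubound; exists b; last by rewrite inver gt_eqF.
  by rewrite /= bE -scalemxAr (enormZ _ (ltW l0)) -/w -/s lsr.
rewrite -(fineK hs) -(fineK bfin) -EFinD lee_fin bE -scalemxAr mxE => hr.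
have : (l * s ^+ 2 <= r * r)%R.
  (* Here [ble] says that [h bstar - h b] is at least [l] times [h bstar - h bhat]. *)
  by apply: le_trans hr; apply: le_trans (ler_wpM2l (ltW l0) fo) _; lra.
by rewrite expr2 mulrA lsr ler_pM2l// leNgt rs.
Qed.
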